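(* Let $F\subseteq\mathbb{R}^d$, $f\colon\mathbb{R}^d\to\mathbb{R}$, and let $(\mathcal{C},\mathcal{D},g,z,\mathcal{T},\epsilon)$ be an $(F,f)$-valid configuration of dimension $n$, with $\mathcal{T}=(V,E,B,\sigma)$. Let $\mathcal{C}'=\{C\times\mathbb{R}:C\in\mathcal{C}\}$, $\mathcal{D}'=\{C\times\mathbb{R}:C\in\mathcal{D}\}$, $g'\colon\mathbb{R}^{n+1}\to\mathbb{R}$, $g'(x_1,\dots,x_{n+1})=g(x_1,\dots,x_n)$, and $\mathcal{T}'=(V,E,B',\sigma)$ with $B'_v=B_v\times\mathbb{R}$ for all $v\in V$. Then $(\mathcal{C}',\mathcal{D}',g',z,\mathcal{T}',\epsilon)$ is also an $(F,f)$-valid configuration (of dimension $n+1$).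
   Context: In dimension $n$, constraints are arbitrary subsets of $\mathbb{R}^n$. For $\mathcal{C}\subseteq\mathcal{P}(\mathbb{R}^n)$ (power set) write $\bigcap\mathcal{C}=\bigcap_{C\in\mathcal{C}}C$, with $\bigcap\emptyset=\mathbb{R}^n$. For a list $\tau=(i_1,\dots,i_k)\in\{\pm1,\dots,\pm n\}^k$ write $\tau(x)=(\mathrm{sgn}(i_1)x_{|i_1|},\dots,\mathrm{sgn}(i_k)x_{|i_k|})\in\mathbb{R}^k$ for $x\in\mathbb{R}^n$ and $\tau(C)=\{\tau(x):x\in C\}$ for $C\subseteq\mathbb{R}^n$; the empty list is allowed. For another list $\tau'=(i'_1,\dots,i'_{k'})$, write $\tau\trianglelefteq\tau'$ if $k\le k'$ and $i_j=i'_j$ for all $1\le j\le k$. For a node $v$ of a directed graph, $\delta^+(v)$ is its set of children. Branching tree: a tuple $\mathcal{T}=(V,E,B,\sigma)$ is a $\mathcal{C}$-consistent branching tree if: (T1) $(V,E)$ is an arborescence with $1\le|V|<\infty$ and root $r\in V$. (T2) Each $v\in V$ has a branching constraint $B_v\subseteq\mathbb{R}^n$, and $B_r=\mathbb{R}^n$. (T3) For all $u\in V$ with $\delta^+(u)\ne\emptyset$: $\bigcap\mathcal{C}\subseteq\bigcup_{v\in\delta^+(u)}B_v$. (T4) Each $v\in V$ has a list $\sigma_v\in\{\pm1,\dots,\pm n\}^{\ell_v}$, $\ell_v\in\{0,\dots,n\}$, with $|(\sigma_v)_1|,\dots,|(\sigma_v)_{\ell_v}|$ pairwise distinct. (T5)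 $\sigma_u\trianglelefteq\sigma_v$ for all $u\in V$, $v\in\delta^+(u)$. (T6) For all $v\in V$ and $1\le i\le\ell_v$: $\max\{\sigma_v(x)_i:x\in\bigcap\mathcal{C}\}<\infty$ (i.e. the set is bounded above). (T7) For all $u\in V$ and $v\ne w$ in $\delta^+(u)$: $\sigma_u(B_v)\cap\sigma_u(B_w)=\emptyset$. Relations: for $v\in V$ let $\mathcal{B}_v=\{B_u: u \text{ is a node on the } r\text{-}v\text{-path in } \mathcal{T}\}$. For $x,y\in\bigcap\mathcal{C}$ let $\mathrm{dcn}(x,y)$ be the deepest node $w\in V$ with $x,y\in\bigcap(\mathcal{C}\cup\mathcal{B}_w)$. For $\epsilon>0$ and $a,b\in\mathbb{R}^k$, let $a\succ_\epsilon b$ mean $a\neq b$ and $a_i\ge b_i+\epsilon$ for the smallest index $i$ with $a_i\ne b_i$. For $x,y\in\bigcap\mathcal{C}$ and $v=\mathrm{dcn}(x,y)$: $x\succeq_{\epsilon,\mathcal{T}}y$ iff $\sigma_v(x)=\sigma_v(y)$ or $\sigma_v(x)\succ_\epsilon\sigma_v(y)$; $x\succ_{\epsilon,\mathcal{T}}y$ iff $\sigma_v(x)\succ_\epsilon\sigma_v(y)$. Configuration: let $F\subseteq\mathbb{R}^d$, $f\colon\mathbb{R}^d\to\mathbb{R}$ (the original problem's dimension $d$ may differ from $n$). A configuration $(\mathcal{C},\mathcal{D},g,z,\mathcal{T},\epsilon)$ of dimension $n$ with $\mathcal{C},\mathcal{D}\subseteq\mathcal{P}(\mathbb{R}^n)$,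 $g\colon\mathbb{R}^n\to\mathbb{R}$, $z\in\mathbb{R}\cup\{\infty\}$, $\mathcal{T}$ a branching tree and $\epsilon$ a real number is $(F,f)$-valid if: (V1) $\mathcal{T}$ is $\mathcal{C}$-consistent and $\epsilon>0$. (V2) If $z<\infty$, there exists $x\in F$ with $f(x)\le z$. (V3) For all real $\hat z<z$, there exists $x\in F$ with $f(x)\le\hat z$ if and only if there exists $x\in\bigcap\mathcal{C}$ with $g(x)\le\hat z$. (V4) For every $x\in\bigcap\mathcal{C}$ with $g(x)<z$ there exists $y\in\bigcap(\mathcal{C}\cup\mathcal{D})$ with $y\succeq_{\epsilon,\mathcal{T}}x$ and $g(y)\le g(x)$. *)

(* Defs.v *)
From HB Require Import structures.
From mathcomp Require Import all_boot all_order all_algebra.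
From mathcomp Require Import all_classical all_reals all_analysis.

Set Implicit Arguments.
Unset Strict Implicit.
Unset Printing Implicit Defensive.

Import Order.TTheory GRing.Theory Num.Theory.

Local Open Scope classical_set_scope.
Local Open Scope ring_scope.

Section Lists.
Variables (R : realType) (n : nat).

(* [coord1 x k] is the k-th coordinate of x counted from 1; it is only
   meaningful for 1 <= k <= n. *)
Definition coord1 (x : 'rV[R]_n) (k : nat) : R :=
  if (insub k.-1 : option 'I_n) is Some j then x 0 j else 0.

(* tau(x) for a list tau of signed 1-based indices *)
Definition list_app (tau : seq int) (x : 'rV[R]_n) : 'rV[R]_(size tau) :=
  \row_j (let i := nth 0 tau j in (sgz i)%:~R * coord1 x `|i|%N).

(* The intersection of the empty family is the whole space. *)
Definition inter (C : set (set 'rV[R]_n)) : set 'rV[R]_n :=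
  \bigcap_(X in C) X.

End Lists.

Definition lex_gt (R : realType) (k : nat) (eps : R) (a b : 'rV[R]_k) : Prop :=
  a <> b /\
  exists i : 'I_k, [/\ a 0 i <> b 0 i,
    forall j : 'I_k, (j < i)%N -> a 0 j = b 0 j
    & b 0 i + eps <= a 0 i].

(* From r there is exactly one directed walk to each node. Such an r is unique,
   so recording it in a branching tree adds no data to (V, E). *)
Definition arborescence (V : finType) (E : rel V) (r : V) : Prop :=
  forall v : V, exists! p : seq V, path E r p /\ last r p = v.

Record branching_tree (R : realType) (n : nat) : Type := BranchingTree {
  node : finType;
  edge : rel node;
  root : node;
  bcons : node -> set 'rV[R]_n;
  blist : node -> seq int
}.

Section Trees.
Variables (R : realType) (n : nat).
Implicit Types (T : branching_tree R n) (C D : set (set 'rV[R]_n)).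

(* The walk from the root to v, without its starting point; it is unique in an
   arborescence. *)
Definition root_walk T (v : node T) : seq (node T) :=
  xget [::] [set p | path (@edge _ _ T) (root T) p /\ last (root T) p = v].

Definition root_path T (v : node T) : seq (node T) := root T :: root_walk v.

Definition depth T (v : node T) : nat := size (root_walk v).

Definition path_cons T (v : node T) : set (set 'rV[R]_n) :=
  [set bcons u | u in [set u | u \in root_path v]].

Definition consistent C T : Prop :=
  [/\ arborescence (@edge _ _ T) (root T),
      bcons (root T) = [set: 'rV[R]_n],
      forall u : node T, (exists v, edge u v) ->
        inter C `<=` \bigcup_(v in [set v | edge u v]) bcons v
    & [/\ forall v : node T,
        [/\ (size (blist v) <= n)%N,
            forall i : int, i \in blist v -> (1 <= `|i|%N <= n)%N
          & uniq [seq `|i|%N | i <- blist v]],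
      forall u v : node T, edge u v -> prefix (blist u) (blist v),
      forall (v : node T) (i : 'I_(size (blist v))),
        has_ubound [set list_app (blist v) x 0 i | x in inter C]
    & forall u v w : node T, edge u v -> edge u w -> v <> w ->
        (list_app (blist u) @` bcons v) `&` (list_app (blist u) @` bcons w)
        = set0]].

(* For x and y in the intersection of C and a C-consistent T, the nodes
   satisfying the predicate form a path starting at the root, so the node of
   maximal depth exists and is unique. *)
Definition dcn C T (x y : 'rV[R]_n) : node T :=
  [arg max_(w > root T | `[< inter (C `|` path_cons w) x /\
                             inter (C `|` path_cons w) y >]) depth w]%N.

Definition tree_ge C (eps : R) T (x y : 'rV[R]_n) : Prop :=
  let s := blist (dcn C T x y) in
  list_app s x = list_app s y \/ lex_gt eps (list_app s x) (list_app s y).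

End Trees.

Record configuration (R : realType) (n : nat) : Type := Configuration {
  cfgC : set (set 'rV[R]_n);
  cfgD : set (set 'rV[R]_n);
  cfg_obj : 'rV[R]_n -> R;
  cfg_z : \bar R;
  cfg_zP : (-oo < cfg_z)%E;
  cfg_tree : branching_tree R n;
  cfg_eps : R
}.

Definition valid (R : realType) (d : nat) (F : set 'rV[R]_d)
    (f : 'rV[R]_d -> R) (n : nat) (K : configuration R n) : Prop :=
  let: Configuration C D g z _ T eps := K in
  [/\ consistent C T /\ 0 < eps,
      (z < +oo)%E -> exists x, F x /\ ((f x)%:E <= z)%E,
      forall zh : R, (zh%:E < z)%E ->
        (exists x, F x /\ f x <= zh) <-> (exists x, inter C x /\ g x <= zh)
    & forall x, inter C x -> ((g x)%:E < z)%E ->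
        exists y, [/\ inter (C `|` D) y, tree_ge C eps T y x & g y <= g x]].

(* X x R, where lsubmx keeps the first n of the n + 1 coordinates *)
Definition cylinder (R : realType) (n : nat) (X : set 'rV[R]_n) :
  set 'rV[R]_(n + 1) := [set x | X (lsubmx x)].

(* Main.v *)
Require Import Defs.
From mathcomp Require Import all_boot all_order all_algebra.
From mathcomp Require Import all_classical all_reals all_analysis.

(** Nothing in a valid configuration can see the new coordinate.  A cylinder
constrains only [lsubmx x], taking cylinders commutes with intersections
([inter_cylinder]), and a list of signed indices of absolute value between [1]
and [n] reads the same values off [x] and off [lsubmx x] ([list_app_lsubmx]).
Hence every notion that the definition of validity is built from, evaluated in
dimension [n + 1], is the corresponding notion of dimension [n] evaluated at the
projected points.
This applies in particular to the deepest common node ([dcn_cylinder]), and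
therefore to the order induced by the branching tree ([tree_ge_cylinder]).

Universal conditions are thus inherited by projecting, and existential ones by
lifting a witness [x] to the point [row_mx x 0], whose projection is [x].  The
arborescence and the lists at its nodes are untouched; the bounds on the length
and the entries of these lists only get weaker. *)

Local Open Scope classical_set_scope.
Local Open Scope ring_scope.

Section Cylinders.
Context {R : realType} {n : nat}.
Implicit Types (C : set (set 'rV[R]_n)) (X : set 'rV[R]_n) (x : 'rV[R]_(n + 1)).

Lemma inter_cylinder C : inter (@cylinder R n @` C) = cylinder (inter C).
Proof.
apply/seteqP; split => x; first by move=> h X CX; apply: (h _ (imageP _ CX)).
by move=> h _ [X CX <-]; apply: h.
Qed.

(** Serves both for [inter (C `|` D)] and for the constraints collected along a
root path, which are cylinders too. *)
Lemma inter_cylinderU C C' :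
  inter (@cylinder R n @` C `|` @cylinder R n @` C') = cylinder (inter (C `|` C')).
Proof. by rewrite -image_setU inter_cylinder. Qed.

Lemma cylinder_row_mx X (x : 'rV[R]_n) (t : 'rV[R]_1) :
  cylinder X (row_mx x t) = X x.
Proof. by rewrite /cylinder /= row_mxKl. Qed.

Lemma coord1_lsubmx x (k : nat) :
  (1 <= k <= n)%N -> coord1 x k = coord1 (lsubmx x) k.
Proof.
case: k => [//|k] /= kn; rewrite /coord1 /=.
have kn1 : (k < n + 1)%N by rewrite addn1 ltnS ltnW.
by rewrite (insubT (fun i => i < n)%N kn) (insubT (fun i => i < n + 1)%N kn1)
  mxE; congr (x 0 _); apply: val_inj.
Qed.

Definition indices_in_range (s : seq int) : Prop :=
  forall i : int, i \in s -> (1 <= `|i|%N <= n)%N.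

Lemma list_app_lsubmx {s : seq int} : indices_in_range s ->
  forall x, list_app s x = list_app s (lsubmx x).
Proof.
move=> hs x; apply/rowP => j; rewrite !mxE; congr (_ * _).
by apply: coord1_lsubmx; apply: hs; apply: mem_nth.
Qed.

(** Carries the disjointness of the images of sibling branching constraints over
to their cylinders. *)
Lemma image_cylinder {s : seq int} X : indices_in_range s ->
  list_app s @` cylinder X = list_app s @` X.
Proof.
move=> hs; apply/seteqP; split => [_ [x Xx <-]|_ [x Xx <-]].
  by exists (lsubmx x); rewrite -?list_app_lsubmx.
exists (row_mx x 0); first by rewrite cylinder_row_mx.
by rewrite (list_app_lsubmx hs) row_mxKl.
Qed.

End Cylinders.

Section CylinderTrees.
Context {R : realType} {n : nat}.
Context {V : finType} (E : rel V) (r : V) (B : V -> set 'rV[R]_n).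
Context (sigma : V -> seq int).
Implicit Types (C : set (set 'rV[R]_n)).

Let T : branching_tree R n := BranchingTree E r B sigma.
Let T' : branching_tree R (n + 1) :=
  BranchingTree E r (fun v => cylinder (B v)) sigma.

Lemma path_cons_cylinder (v : V) :
  @path_cons _ _ T' v = @cylinder R n @` @path_cons _ _ T v.
Proof. by rewrite /path_cons image_comp. Qed.

(** Depth depends on the digraph alone, so both sides maximize the same function
over the same set of nodes. *)
Lemma dcn_cylinder C (x y : 'rV[R]_(n + 1)) :
  dcn (@cylinder R n @` C) T' x y = dcn C T (lsubmx x) (lsubmx y) :> V.
Proof.
have same (w : V) : inter (@cylinder R n @` C `|` @path_cons _ _ T' w)
    = cylinder (inter (C `|` @path_cons _ _ T w)).
  by rewrite path_cons_cylinder inter_cylinderU.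
rewrite /dcn /=; congr (@arg_max V r _ _); apply/funext => w.
by rewrite same.
Qed.

Lemma tree_ge_cylinder C (eps : R) (x y : 'rV[R]_(n + 1)) :
  (forall v, @indices_in_range n (sigma v)) ->
  tree_ge (@cylinder R n @` C) eps T' x y =
  tree_ge C eps T (lsubmx x) (lsubmx y).
Proof.
move=> hs; rewrite /tree_ge /= dcn_cylinder.
by rewrite (list_app_lsubmx (hs _) x) (list_app_lsubmx (hs _) y).
Qed.

Lemma consistent_cylinder C :
  consistent C T -> consistent (@cylinder R n @` C) T'.
Proof.
move=> [arb rootT cover [wf pre bnd disj]].
have hs v : @indices_in_range n (sigma v) by case: (wf v).
split => //=; first by move: rootT => /= ->.
  by move=> u /cover sub x; rewrite inter_cylinder => /sub[v Ev Bv]; exists v.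
split => //=.
- move=> v; have [sz le_n un] := wf v; split => //.
    by rewrite (leq_trans sz)// leq_addr.
  by move=> i /le_n /andP[-> /=] /leq_trans; apply; rewrite leq_addr.
- move=> v i; have [M ubM] := bnd v i; exists M => _ [x Cx <-].
  rewrite (list_app_lsubmx (hs v)); apply: ubM; exists (lsubmx x) => //.
  by move: Cx; rewrite inter_cylinder.
- by move=> u v w uv uw vw; rewrite !image_cylinder//; apply: disj.
Qed.

End CylinderTrees.

Theorem theorem12 (R : realType) (d n : nat)
    (F : set 'rV[R]_d) (f : 'rV[R]_d -> R)
    (C D : set (set 'rV[R]_n)) (g : 'rV[R]_n -> R)
    (z : \bar R) (hz : (-oo < z)%E)
    (V : finType) (E : rel V) (r : V)
    (B : V -> set 'rV[R]_n) (sigma : V -> seq int) (eps : R)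
    (hvalid : valid F f
      (Configuration C D g hz (BranchingTree E r B sigma) eps)) :
  valid F f
    (Configuration (@cylinder R n @` C) (@cylinder R n @` D)
       (fun x : 'rV[R]_(n + 1) => g (lsubmx x)) hz
       (BranchingTree E r (fun v => cylinder (B v)) sigma) eps).
Proof.
case: hvalid => -[consT eps0] primal same dom.
have hs v : @indices_in_range n (sigma v).
  by case: consT => _ _ _ [wf _ _ _]; case: (wf v).
split => //; first by split => //; apply: consistent_cylinder.
- move=> zh /same [FC CF]; split => [/FC[x [Cx gx]]|[x [Cx gx]]].
    exists (row_mx x 0).
    by rewrite inter_cylinder cylinder_row_mx row_mxKl.
  by apply: CF; exists (lsubmx x); move: Cx; rewrite inter_cylinder.
- move=> x; rewrite inter_cylinder => /dom{}dom /dom[y [CDy yx gyx]].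
  exists (row_mx y 0).
  by rewrite inter_cylinderU cylinder_row_mx tree_ge_cylinder// !row_mxKl.
Qed.
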